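(* Let $p,q$ be primes with $p>2$, $q\equiv 1\pmod p$ and $q\not\equiv 1\pmod{p^2}$, let $r$ be a fixed element of order $p$ in $\mathbb{Z}_q^\times$, and let $w$ be a fixed quadratic non-residue modulo $p$. Up to isomorphism, the left braces with additive group isomorphic to $\mathbb{Z}_p^2\times\mathbb{Z}_q$ and with $|\ker\lambda|=q$ are exactly the two braces $B_s$ for $s\in\{1,w\}$, which are not isomorphic to each other, where $B_s=(\mathbb{Z}_p\times\mathbb{Z}_p\times\mathbb{Z}_q,+,\circ)$ with $$\begin{pmatrix} n\\ m\\ l\end{pmatrix}+\begin{pmatrix} x\\ y\\ z\end{pmatrix}=\begin{pmatrix} n+x\\ m+y\\ l+z\end{pmatrix},\qquad \begin{pmatrix} n\\ m\\ l\end{pmatrix}\circ\begin{pmatrix} x\\ y\\ z\end{pmatrix}=\begin{pmatrix} n+x+yms^{-1}\\ m+y\\ l+z\,r^{\,n-m\frac{m-s}{2s}}\end{pmatrix}$$ for all $n,m,x,y\in\mathbb{Z}_p$ and $l,z\in\mathbb{Z}_q$ (the exponent of $r$ being computed in $\mathbb{Z}_p$). In particular, $(B_s,\circ)\cong\mathbb{Z}_p\times(\mathbb{Z}_q\rtimes_r\mathbb{Z}_p)$.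
   Context: A skew (left) brace is a triple $(B,+,\circ)$ where $(B,+)$ and $(B,\circ)$ are groups such that $a\circ(b+c)=a\circ b-a+a\circ c$ for all $a,b,c\in B$; it is a left brace if $(B,+)$ is abelian. The map $\lambda:(B,\circ)\to\mathrm{Aut}(B,+)$, $\lambda_a(b)=-a+a\circ b$, is a group homomorphism, with kernel $\ker\lambda$. Isomorphisms are bijections preserving both operations. $\mathbb{Z}_p\times(\mathbb{Z}_q\rtimes_r\mathbb{Z}_p)=\langle\sigma,\tau,\epsilon\mid\sigma^p=\tau^p=\epsilon^q=1,\ [\epsilon,\tau]=[\tau,\sigma]=1,\ \sigma\epsilon\sigma^{-1}=\epsilon^r\rangle$. *)

(* Defs.v *)
From HB Require Import structures.
From mathcomp Require Import all_boot all_order all_algebra all_fingroup.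
From mathcomp Require Import ring zify.

Set Implicit Arguments.
Unset Strict Implicit.
Unset Printing Implicit Defensive.

Import GRing.Theory.
Local Open Scope ring_scope.

(* A left brace is a skew brace with abelian additive group, so its additive
   group is a [zmodType]; the circle operation is the [groupType] law [*%g]. *)
HB.mixin Record isLeftBrace B of GRing.Zmodule B & monoid.Group B := {
  brace_mulDr : forall a b c : B, (a * (b + c))%g = (a * b)%g - a + (a * c)%g
}.

#[short(type="leftBraceType")]
HB.structure Definition LeftBrace :=
  { B of GRing.Zmodule B & monoid.Group B & isLeftBrace B }.

#[short(type="finLeftBraceType")]
HB.structure Definition FinLeftBrace :=
  { B of LeftBrace B & FinRing.Zmodule B & FinGroup B }.

Definition lambda (B : leftBraceType) (a b : B) : B := - a + (a * b)%g.

Definition ker_lambda (B : finLeftBraceType) : {set B} :=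
  [set a : B | [forall b : B, lambda a b == b]].

Definition brace_isomorphic (A B : leftBraceType) : Prop :=
  exists f : A -> B, [/\ bijective f,
    {morph f : a b / a + b} & {morph f : a b / (a * b)%g}].

Definition additively_isomorphic (U V : zmodType) : Prop :=
  exists f : {additive U -> V}, bijective f.

(* The triple (n, m, l) is encoded as ((n, m), l).  The first three
   hypotheses are parameters of the type because the circle operation is a
   group law only under them: the exponent in F_p is lifted to a natural
   number, which needs r ^ p = 1, and 2 has to be invertible modulo p. *)
Definition braceB (p q : nat) (r : {unit 'F_q}) (p_pr : prime p)
    (p_gt2 : (2 < p)%N) (ord_r : #[r]%g = p) (s : 'F_p) : Type :=
  ('F_p * 'F_p * 'F_q)%type.

Section BraceB.

Variables (p q : nat) (r : {unit 'F_q}).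
Hypotheses (p_pr : prime p) (p_gt2 : (2 < p)%N) (ord_r : #[r]%g = p).
Variable s : 'F_p.

Local Notation B := (braceB p_pr p_gt2 ord_r s).

HB.instance Definition _ := Finite.copy B ('F_p * 'F_p * 'F_q)%type.
HB.instance Definition _ := GRing.Zmodule.copy B ('F_p * 'F_p * 'F_q)%type.

Definition exponentB (n m : 'F_p) : 'F_p := n - m * ((m - s) / (2 * s)).

Definition circB (a b : B) : B :=
  let: (n, m, l) := a in
  let: (x, y, z) := b in
  (n + x + y * m * s^-1,
   m + y,
   l + z * val r ^+ exponentB n m).

Definition circB_inv (a : B) : B :=
  let: (n, m, l) := a in
  (- n + m * m * s^-1,
   - m,
   - (l * val r ^+ exponentB (- n + m * m * s^-1) (- m))).

Lemma expr_FpD (i j : 'F_p) :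
  val r ^+ (i + j : 'F_p)%R = val r ^+ i * val r ^+ j.
Proof.
rewrite -exprD -!FinRing.val_unitX; congr (val _).
rewrite -[LHS]expg_mod_order -[RHS]expg_mod_order ord_r /=.
move: (nat_of_ord i) (nat_of_ord j) => k l.
by rewrite (Fp_cast p_pr) modn_mod.
Qed.

Lemma double_half : (2 : 'F_p) * 2^-1 = 1.
Proof.
have := val_Fp_nat p_pr 2; rewrite modn_small // => val2.
by rewrite mulfV //; apply/eqP => two0; rewrite two0 in val2.
Qed.

Lemma exponentD (n m x y : 'F_p) :
  exponentB (n + x + y * m * s^-1) (m + y) = exponentB n m + exponentB x y.
Proof.
rewrite /exponentB invfM; have := double_half.
move: (2^-1) (s^-1) => h t h2.
have -> : y * m * t = 2 * h * (y * m * t) by rewrite h2 mul1r.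
ring.
Qed.

Lemma circBA : associative circB.
Proof.
move=> [[n m] l] [[x y] z] [[u v] w]; rewrite /circB.
congr (_, _, _); [ring | ring |].
by rewrite exponentD expr_FpD; ring.
Qed.

Lemma circB0 : left_id (0 : B) circB.
Proof.
move=> [[x y] z]; rewrite /circB.
congr (_, _, _); rewrite ?add0r ?mulr0 ?mul0r ?addr0 //.
by rewrite /exponentB mul0r subr0 expr0 mulr1.
Qed.

Lemma circBV : left_inverse (0 : B) circB_inv circB.
Proof.
move=> [[n m] l] /=.
by congr (_, _, _); ring.
Qed.

HB.instance Definition _ := Finite_isGroup.Build B circBA circB0 circBV.

Lemma circB_mulDr (a b c : B) :
  (a * (b + c))%g = (a * b)%g - a + (a * c)%g.
Proof.
case: a b c => [[n m] l] [[x y] z] [[u v] w].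
by congr (_, _, _) => /=; ring.
Qed.

HB.instance Definition _ := isLeftBrace.Build B circB_mulDr.

End BraceB.

(* Main.v *)
Require Import Defs.
From HB Require Import structures.
From mathcomp Require Import all_boot all_order all_algebra all_fingroup.
From mathcomp Require Import all_solvable finfield ring.

(* Let [P] and [Q] be the Sylow subgroups of [(A, +)]; as left ideals they are
   subgroups of [(A, o)] as well.  [ker lambda] is a normal Sylow [q]-subgroup
   of [(A, o)], so it is [Q], and [lambda] is determined by its restriction to
   [P], on which it is injective.  The [p]-group [(P, o)] fixes a nonzero
   vector of [P], and it is abelian of order [p ^ 2]; in a basis starting with
   the fixed vector, commutativity forces
     [lambda_(n, m) (x, y) = (x + t * y * m, y)].
   As [p ^ 2] does not divide [q - 1], [lambda_(n, m)] acts on [Q] as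
   [r ^ d (n, m)], and [d : (P, o) -> F_p] being a morphism makes it equal to
   [al * n + be * m - al * t * m ^ 2 / 2], where [t] and [al] are nonzero by
   injectivity.  A change of basis then leads to [B_s] for any [s] such that
   [al * t * s] is a nonzero square. *)

Set Implicit Arguments.
Unset Strict Implicit.
Unset Printing Implicit Defensive.

Import GRing.Theory.
Local Open Scope ring_scope.

(** * The homomorphism [lambda] of a left brace *)

Section LambdaTheory.

Variable B : leftBraceType.
Implicit Types a b c : B.

(** At [a = 1], [b = c = 0] the brace law reads [0 = 0 - 1 + 0], where [1] is the circle
    identity. *)
Lemma brace_one : 1%g = 0 :> B.
Proof.
have := brace_mulDr (1%g : B) 0 0.
by rewrite addr0 mul1g add0r addr0 => /eqP; rewrite eq_sym oppr_eq0 => /eqP.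
Qed.

Lemma brace_mulE a b : (a * b)%g = a + lambda a b.
Proof. by rewrite /lambda addrA subrr add0r. Qed.

Lemma lambda_is_zmod_morphism a : zmod_morphism (lambda a).
Proof.
have lamD b c : lambda a (b + c) = lambda a b + lambda a c.
  by rewrite /lambda brace_mulDr !addrA.
by move=> b c; apply/eqP; rewrite eq_sym subr_eq -lamD subrK.
Qed.

HB.instance Definition _ a :=
  GRing.isZmodMorphism.Build B B (lambda a) (lambda_is_zmod_morphism a).

(** After adding [a o b] to both sides, this is associativity of the circle operation. *)
Lemma lambdaM a b c : lambda (a * b)%g c = lambda a (lambda b c).
Proof.
apply: (@addrI _ (a * b)%g); rewrite -brace_mulE -mulgA (brace_mulE b c).
by rewrite [LHS]brace_mulE (raddfD (lambda a) b) /= addrA -brace_mulE.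
Qed.

Lemma lambda1 b : lambda 1%g b = b.
Proof. by rewrite /lambda mul1g brace_one oppr0 add0r. Qed.

Lemma lambdaK a : cancel (lambda a) (lambda a^-1%g).
Proof. by move=> b; rewrite -lambdaM mulVg lambda1. Qed.

End LambdaTheory.

Lemma brace_iso_lambda (A B : leftBraceType) (f : A -> B) :
  {morph f : a b / a + b} -> {morph f : a b / (a * b)%g} ->
  {morph f : a b / lambda a b}.
Proof.
move=> fD fM a b; apply: (@addrI _ (f a)).
by rewrite -fD -(brace_mulE a) fM brace_mulE.
Qed.

(** * Arithmetic in prime fields *)

Section PrimeFields.

Variables (p : nat).
Hypothesis p_pr : prime p.

Lemma Fp_natr (x : 'F_p) : (x : nat)%:R = x.
Proof. exact: natr_Zp. Qed.

Lemma mulrn_FpE (x y : 'F_p) : x *+ y = x * y.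
Proof. by rewrite -mulr_natr Fp_natr. Qed.

Lemma ltn_Fp (x : 'F_p) : (x < p)%N.
Proof. by rewrite -[X in (_ < X)%N](Fp_cast p_pr) ltn_ord. Qed.

Lemma mulrn_Fp (x : 'F_p) : x *+ p = 0.
Proof. by rewrite mulrn_pchar // pchar_Fp. Qed.

Lemma mulrn_Fp_eq0 (x : 'F_p) n : coprime p n -> (x *+ n == 0) = (x == 0).
Proof.
move=> co; rewrite -mulr_natr mulf_eq0 orbC -(dvdn_pcharf (pchar_Fp p_pr)).
by rewrite prime_coprime // in co; rewrite (negPf co).
Qed.

Lemma additive_Fp_endoE (f : 'F_p -> 'F_p) :
  {morph f : x y / x + y} -> forall x, f x = f 1 * x.
Proof.
move=> fD; have f0 : f 0 = 0 by apply: (@addrI _ (f 0)); rewrite -fD !addr0.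
have fn n : f n%:R = f 1 * n%:R.
  by elim: n => [|n IHn]; rewrite ?mulr0 // !mulrSr fD IHn mulrDr mulr1.
by move=> x; rewrite -{1}(Fp_natr x) fn Fp_natr.
Qed.

Lemma expr_Fp (x : 'F_p) : x ^+ p = x.
Proof. by have := expf_card x; rewrite card_Fp. Qed.

(* The unit group of [F_p] is cyclic, and a product of two odd powers of a
   generator is an even one. *)
Lemma square_or_nonresidue_square (u w : 'F_p) :
    u != 0 -> (forall x : 'F_p, x ^+ 2 != w) ->
  exists2 s, s = 1 \/ s = w & exists C, C ^+ 2 = u * s.
Proof.
move=> u0 wN; have w0 : w != 0 by have := wN 0; rewrite expr0n /= eq_sym.
have [g gE] := cyclicP (field_unit_group_cyclic [set: {unit 'F_p}]).
have powg (x : 'F_p) : x != 0 -> exists i, x = val g ^+ i.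
  rewrite -unitfE => Ux.
  have : FinRing.unit 'F_p Ux \in <[g]>%g by rewrite -gE inE.
  case/cycleP=> i /(congr1 val) /=; rewrite FinRing.val_unitX => ->.
  by exists i.
have [[i uE] [j wE]] := (powg u u0, powg w w0).
have jodd : odd j.
  apply: contraR (wN (val g ^+ j./2)) => /negPf jev.
  by rewrite -exprM muln2 wE -{2}(odd_double_half j) jev.
case iodd: (odd i); last first.
  exists 1; [by left | exists (val g ^+ i./2)].
  by rewrite mulr1 -exprM muln2 uE -{2}(odd_double_half i) iodd.
exists w; [by right | exists (val g ^+ (i + j)./2)].
rewrite -exprM muln2 uE wE -exprD -[in RHS](odd_double_half (i + j)).
by rewrite oddD iodd jodd.
Qed.

End PrimeFields.

(** * The braces [B_s]: kernel, additive group and isomorphisms *)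

Section BraceB.

Variables (p q : nat) (p_pr : prime p) (q_pr : prime q) (p_gt2 : (2 < p)%N).
Variables (r : {unit 'F_q}) (ord_r : #[r]%g = p).

Local Notation B s := (braceB p_pr p_gt2 ord_r s : finLeftBraceType).
Local Notation V := ('F_p * 'F_p * 'F_q)%type.

Lemma prim_root_r : p.-primitive_root (val r : 'F_q).
Proof.
have p_gt0 := prime_gt0 p_pr.
have rp1 : (val r : 'F_q) ^+ p = 1.
  by rewrite -FinRing.val_unitX -ord_r expg_order.
have [m m_prim m_dvd] := prim_order_exists p_gt0 rp1.
suff -> : p = m by [].
apply/eqP; rewrite eqn_dvd m_dvd andbT -ord_r order_dvdn.
by apply/eqP/val_inj; rewrite FinRing.val_unitX (prim_expr_order m_prim).
Qed.

(** If [p = q], then [r ^ q = r] by Fermat while [r] has order [q], so [q] would be congruent to [1]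
    modulo itself. *)
Lemma coprime_pq : coprime p q.
Proof.
rewrite prime_coprime // dvdn_prime2 //; apply/negP => /eqP pq.
have /eqP := expr_Fp q_pr (val r); rewrite -[X in _ == X]expr1.
by rewrite (eq_prim_root_expr prim_root_r) -pq modnn modn_small ?prime_gt1.
Qed.

Lemma expr_r_inj (i j : 'F_p) :
  (val r : 'F_q) ^+ i = (val r : 'F_q) ^+ j -> i = j.
Proof.
move=> /eqP; rewrite (eq_prim_root_expr prim_root_r) !modn_small ?ltn_Fp //.
by move=> /eqP /val_inj.
Qed.

Lemma exponentB0 (s n : 'F_p) : exponentB s n 0 = n.
Proof. by rewrite /exponentB mul0r subr0. Qed.

Lemma lambdaBE (s n m : 'F_p) (l : 'F_q) (x y : 'F_p) (z : 'F_q) :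
  lambda ((n, m, l) : B s) (x, y, z) =
    (x + y * m * s^-1, y, z * (val r : 'F_q) ^+ exponentB s n m).
Proof. by congr (_, _, _) => /=; ring. Qed.

Lemma ker_lambdaB (s : 'F_p) : s != 0 ->
  ker_lambda (B s) = [set ((0, 0, l) : B s) | l : 'F_q].
Proof.
move=> s0; apply/setP => -[[n m] l]; rewrite inE.
apply/forallP/imsetP => [lam | [l' _ [-> -> ->]] [[x y] z]]; last first.
  by rewrite lambdaBE exponentB0 !mulr0 mul0r expr0 mulr1 addr0.
have lamE b : lambda ((n, m, l) : B s) b = b by apply/eqP.
(* [(0, 1, 0)] goes to [(m / s, 1, 0)], forcing [m = 0]; then [(0, 0, 1)] goes to [(0, 0, r ^ n)],
   forcing [n = 0]. *)
have /eqP := congr1 (fun v : V => v.1.1) (lamE (0, 1, 0)).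
rewrite lambdaBE /= mul1r add0r mulf_eq0 invr_eq0 (negPf s0) orbF => /eqP m0.
have := congr1 (fun v : V => v.2) (lamE (0, 0, 1)).
rewrite lambdaBE m0 exponentB0 mul1r => /(@expr_r_inj n 0) ->.
by exists l.
Qed.

Lemma card_ker_lambdaB (s : 'F_p) : s != 0 -> #|ker_lambda (B s)| = q.
Proof.
by move=> s0; rewrite ker_lambdaB // card_imset ?card_Fp // => x y [].
Qed.

Lemma additively_isomorphic_B (s : 'F_p) : additively_isomorphic (B s) V.
Proof.
pose f (a : B s) : V := a.
have fB : zmod_morphism f by [].
pose F := GRing.isZmodMorphism.Build _ _ f fB.
pose G : {additive B s -> V} := HB.pack f F.
by exists G; exists (id : V -> B s).
Qed.

Lemma addr_triple (x x' y y' : 'F_p) (z z' : 'F_q) :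
  (x, y, z) + (x', y', z') = (x + x', y + y', z + z').
Proof. by []. Qed.

Lemma mulrn_triple (v : V) k : v *+ k = (v.1.1 *+ k, v.1.2 *+ k, v.2 *+ k).
Proof.
case: v => [[x y] z]; elim: k => // k IHk.
by rewrite !mulrS IHk.
Qed.

(** An additive map preserves the [p]-torsion [F_p^2] and the [q]-torsion [F_q] of [V], so it is
    block diagonal, with entries read off the basis vectors. *)
Lemma additive_VE (g : {additive V -> V}) (x y : 'F_p) (z : 'F_q) :
  g (x, y, z) = ((g (1, 0, 0)).1.1 * x + (g (0, 1, 0)).1.1 * y,
                 (g (1, 0, 0)).1.2 * x + (g (0, 1, 0)).1.2 * y,
                 (g (0, 0, 1)).2 * z).
Proof.
have gp v : v.2 = 0 -> (g v).2 = 0.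
  move=> v0; have vp : v *+ p = 0.
    by rewrite mulrn_triple v0 !mulrn_Fp // mul0rn.
  have /(congr1 snd) := raddfMn g p v; rewrite vp raddf0 mulrn_triple /=.
  move/esym/eqP; rewrite mulrn_Fp_eq0 //; first by move/eqP.
  by rewrite coprime_sym coprime_pq.
have gq v : v.1 = 0 -> (g v).1 = 0.
  move=> v0; have vq : v *+ q = 0.
    by rewrite mulrn_triple v0 !mul0rn mulrn_Fp.
  have /(congr1 fst) := raddfMn g q v; rewrite vq raddf0 mulrn_triple /=.
  move=> /esym/eqP; rewrite xpair_eqE !mulrn_Fp_eq0 ?coprime_pq //.
  by case: (g v) => [[? ?] ?] /= /andP[/eqP -> /eqP ->].
have -> : ((x, y, z) : V) = (1, 0, 0) *+ x + (0, 1, 0) *+ y + (0, 0, 1) *+ z.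
  rewrite !mulrn_triple /= !mul0rn !Fp_natr //.
  by rewrite !addr_triple !addr0 !add0r.
rewrite !raddfD !raddfMn.
have := gp (1, 0, 0) erefl; have := gp (0, 1, 0) erefl.
have := gq (0, 0, 1) erefl.
case: (g (1, 0, 0)) => [[a b] c]; case: (g (0, 1, 0)) => [[a' b'] c'].
case: (g (0, 0, 1)) => [d c''] /= -> -> ->.
by rewrite !mulrn_triple !mul0rn !addr_triple !addr0 !add0r /= !mulrn_FpE.
Qed.

(* Comparing [lambda_a b - b] through an isomorphism: the first basis vector
   goes to itself because it acts as [r] on both sides, and then the second
   coordinate [C] of the image of the second basis vector satisfies
   [C ^ 2 / s' = 1 / s]. *)
Lemma braceB_iso_square (s s' : 'F_p) : s != 0 -> s' != 0 ->
  brace_isomorphic (B s) (B s') -> exists C, C ^+ 2 * s = s'.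
Proof.
move=> s0 s'0 [f [f_bij fD fM]].
have flam := brace_iso_lambda fD fM.
have fB : zmod_morphism (f : V -> V).
  by move=> a b; apply/eqP; rewrite eq_sym subr_eq -[X in _ == X]fD subrK.
pose g : {additive V -> V} := HB.pack (f : V -> V)
  (GRing.isZmodMorphism.Build _ _ (f : V -> V) fB).
have fE x y z : f (x, y, z) = _ := additive_VE g x y z.
move: fE; rewrite /g /=.
move: (f (1, 0, 0)).1.1 (f (1, 0, 0)).1.2 => A A'.
move: (f (0, 1, 0)).1.1 (f (0, 1, 0)).1.2 (f (0, 0, 1)).2 => D C u fE.
(* [f] maps [lambda_(0,1,0) (0, 1, 0) = (1/s, 1, 0)] to [(A/s + D, A'/s + C, 0)], which must equal
   [lambda_(D,C,0) (D, C, 0)], whose second coordinate is [C]. *)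
have := flam (0, 1, 0) (0, 1, 0).
rewrite lambdaBE !fE lambdaBE !(mul1r, mul0r, mulr1, mulr0, add0r) => h.
have A'0 : A' = 0.
  have /eqP : A' * s^-1 + C = C := congr1 (fun v : V => v.1.2) h.
  rewrite eq_sym -subr_eq subrr eq_sym.
  by rewrite mulf_eq0 invr_eq0 (negPf s0) orbF => /eqP.
have AC : A * s^-1 = C * C * s'^-1.
  have : A * s^-1 + D = D + C * C * s'^-1 := congr1 (fun v : V => v.1.1) h.
  by rewrite addrC => /addrI.
have u0 : u != 0.
  apply/eqP => u0; have /(bij_inj f_bij) [/eqP] : f (0, 0, 1) = f (0, 0, 0).
    by rewrite !fE u0 !mul0r.
  by rewrite oner_eq0.
have := flam (1, 0, 0) (0, 0, 1); rewrite lambdaBE !fE lambdaBE A'0.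
rewrite !(mul1r, mul0r, mulr1, mulr0, add0r, addr0) !exponentB0 => {}h.
have A1 : A = 1.
  apply: expr_r_inj; apply: (mulfI u0).
  by have := congr1 (fun v : V => v.2) h.
exists C; rewrite A1 mul1r in AC.
by rewrite expr2 -(divfK s'0 (C * C)) -AC mulrAC mulVf // mul1r.
Qed.

End BraceB.

(** * Presentation of the circle group of [B_s] *)

Lemma expg_Fp_nat (p : nat) (gT : finGroupType) (x : gT) (n : nat) : prime p ->
  (x ^+ p = 1 -> x ^+ (n%:R : 'F_p)%R = x ^+ n)%g.
Proof. by move=> p_pr xp; rewrite val_Fp_nat // expg_mod. Qed.

Lemma expg_FpD (p : nat) (gT : finGroupType) (x : gT) (i j : 'F_p) : prime p ->
  (x ^+ p = 1 -> x ^+ (i + j : 'F_p)%R = x ^+ i * x ^+ j)%g.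
Proof.
by move=> p_pr xp; rewrite -expgD -[RHS](expg_Fp_nat _ p_pr xp) natrD !Fp_natr.
Qed.

Lemma expg_FpM (p : nat) (gT : finGroupType) (x : gT) (i j : 'F_p) : prime p ->
  (x ^+ p = 1 -> x ^+ (i * j : 'F_p)%R = x ^+ i ^+ j)%g.
Proof.
by move=> p_pr xp; rewrite -expgM -[RHS](expg_Fp_nat _ p_pr xp) natrM !Fp_natr.
Qed.

(** Conjugation by [x] multiplies exponents of [y] by [u], so moving [x ^ k] past [y ^ l] multiplies
    [l] by [u ^ k]; these exponents live in [F_q] because [y ^ q = 1]. *)
Lemma expg_conjg_Fp (q : nat) (gT : finGroupType) (x y : gT) (u l : 'F_q) k :
    prime q -> (y ^+ q = 1 -> x * y * x^-1 = y ^+ u ->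
  x ^+ k * y ^+ l = y ^+ (l * u ^+ k : 'F_q)%R * x ^+ k)%g.
Proof.
move=> q_pr yq xy.
have conjE z : (x * z * x^-1 = z ^ x^-1)%g by rewrite conjgE invgK mulgA.
have xyl (i : 'F_q) : (x * y ^+ i = y ^+ (i * u : 'F_q)%R * x)%g.
  apply: (mulIg x^-1%g); rewrite mulgK mulrC expg_FpM // -xy.
  by rewrite !conjE conjXg.
elim: k l => [|k IHk] l; first by rewrite expr0 mulr1 !expg0 mul1g mulg1.
by rewrite expgSr -mulgA xyl mulgA IHk -mulgA -expgSr exprS mulrA.
Qed.

(** Turns the tuple equality behind the [Grp] notation into separate relations on named
    generators. *)
Lemma homgGrp_gens (gT : finGroupType) (H : {set gT}) (p q k : nat) :
  reflect (exists x y z : gT,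
    [/\ <[x]> <*> <[y]> <*> <[z]> = H, [/\ x ^+ p = 1, y ^+ p = 1 & z ^+ q = 1],
        [~ z, y] = 1, [~ y, x] = 1 & x * z * x^-1 = z ^+ k])%g
  (H \homg Grp (sigma : tau : epsilon :
     sigma ^+ p = 1, tau ^+ p = 1, epsilon ^+ q = 1,
     [~ epsilon, tau] = 1, [~ tau, sigma] = 1,
     sigma * epsilon * sigma^-1 = epsilon ^+ k))%g.
Proof.
apply: (iffP existsP) => [[[[x y] z]] | [x] [y] [z] [defH [xp yp zq] zy yx xz]].
  by move=> /eqP[defH xp yp zq zy yx xz]; exists x, y, z.
exists (x, y, z); rewrite /= !xpair_eqE /=.
by rewrite defH xp yp zq zy yx xz !eqxx.
Qed.

Section Presentation.

Variables (p q : nat) (p_pr : prime p) (q_pr : prime q) (p_gt2 : (2 < p)%N).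
Variables (r : {unit 'F_q}) (ord_r : #[r]%g = p) (s : 'F_p).

Local Notation B := (braceB p_pr p_gt2 ord_r s).

(* In the coordinates [(j, m)], where [j] is the exponent of [r] in the action
   on [F_q], the circle operation on the [p]-part is addition. *)
Definition pelt (j m : 'F_p) : B := (j + m * ((m - s) / (2 * s)), m, 0).
Definition qelt (l : 'F_q) : B := (0, 0, l).

Lemma exponent_pelt j m : exponentB s (pelt j m).1.1 m = j.
Proof. by rewrite /exponentB addrK. Qed.

Lemma qelt_pelt n m l :
  (n, m, l) = (qelt l * pelt (exponentB s n m) m)%g :> B.
Proof.
rewrite /qelt /pelt /exponentB subrK; congr (_, _, _); rewrite ?add0r //.
  by rewrite mulr0 mul0r addr0.
by rewrite mul0r addr0.
Qed.

Lemma peltM j m j' m' : (pelt j m * pelt j' m')%g = pelt (j + j') (m + m').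
Proof.
congr (_, _, _); last by rewrite mul0r addr0.
(* The exponent is additive for the circle operation, and together with the second coordinate it
   determines the first one. *)
have := exponentD p_pr p_gt2 s (pelt j m).1.1 m (pelt j' m').1.1 m'.
by rewrite !exponent_pelt => /(canRL (subrK _)) ->.
Qed.

Lemma qeltM l l' : (qelt l * qelt l')%g = qelt (l + l').
Proof.
by congr (_, _, _); rewrite ?exponentB0 /= ?expr0 ?mulr1 ?mulr0 ?mul0r ?addr0.
Qed.

Lemma pelt_qelt j m l :
  (pelt j m * qelt l)%g = (qelt (l * (val r : 'F_q) ^+ j)%R * pelt j m)%g.
Proof.
have := qelt_pelt (pelt j m).1.1 m (l * (val r : 'F_q) ^+ j).
rewrite (exponent_pelt j m). move=> <-; congr (_, _, _).
- by rewrite !mul0r !addr0.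
- by rewrite addr0.
- by rewrite add0r exponent_pelt.
Qed.

Lemma peltX j m k : (pelt j m ^+ k)%g = pelt (j *+ k) (m *+ k).
Proof.
elim: k => [|k IHk]; last by rewrite expgS IHk peltM -!mulrS.
by rewrite expg0 brace_one !mulr0n /pelt mul0r addr0.
Qed.

Lemma qeltX l k : (qelt l ^+ k)%g = qelt (l *+ k).
Proof.
elim: k => [|k IHk]; last by rewrite expgS IHk qeltM -!mulrS.
by rewrite expg0 brace_one !mulr0n.
Qed.

(** The generators are [pelt 1 0], [pelt 0 1] and [qelt 1]. Conversely, for elements of any group
    satisfying the relations, the normal form [epsilon^l sigma^j tau^m] defines a morphism from
    [B_s] onto the subgroup they generate. *)
Lemma braceB_presentation :
  ([set: B] \isog Grp (sigma : tau : epsilon :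
     sigma ^+ p = 1, tau ^+ p = 1, epsilon ^+ q = 1,
     [~ epsilon, tau] = 1, [~ tau, sigma] = 1,
     sigma * epsilon * sigma^-1 = epsilon ^+ (val r : 'F_q)))%g.
Proof.
have pelt0 : pelt 0 0 = 1%g by rewrite brace_one /pelt mul0r addr0.
have qelt0 : qelt 0 = 1%g by rewrite brace_one.
apply: intro_isoGrp => [|rT H].
  apply/homgGrp_gens; exists (pelt 1 0), (pelt 0 1), (qelt 1); split.
  - apply/eqP; rewrite eqEsubset subsetT; apply/subsetP => -[[n m] l] _.
    rewrite qelt_pelt -(Fp_natr l) -qeltX; move: (exponentB s n m) => j.
    have -> : pelt j m = (pelt 1%R 0 ^+ j * pelt 0 1%R ^+ m)%g.
      by rewrite !peltX peltM !mul0rn !Fp_natr addr0 add0r.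
    have := subxx (<[pelt 1%R 0]> <*> <[pelt 0 1%R]> <*> <[qelt 1%R]>)%g.
    rewrite {1}join_subG join_subG !cycle_subG => /andP[/andP[sG tG] eG].
    by rewrite !groupM ?groupX.
  - by rewrite !peltX qeltX !mulrn_Fp // !mul0rn pelt0 qelt0.
  - by apply/eqP/commgP; rewrite /commute pelt_qelt expr0 mulr1.
  - by apply/eqP/commgP; rewrite /commute !peltM addrC [1 + 0]addrC.
  - rewrite pelt_qelt mul1r mulgK qeltX Fp_natr.
    exact: erefl.
case/homgGrp_gens => x [y] [z] [defH [xp yp zq] zy yx xz].
pose f (a : B) : rT := let: (n, m, l) := a in
  (z ^+ l * (x ^+ exponentB s n m * y ^+ m))%g.
have yx' := commgP (introT eqP yx); have zy' := commgP (introT eqP zy).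
have fM : {in [set: B] &, {morph f : a b / (a * b)%g}}.
  move=> [[n m] l] [[n' m'] l'] _ _.
  have -> : f (((n, m, l) : B) * ((n', m', l') : B))%g =
      (z ^+ (l + l' * val r ^+ exponentB s n m : 'F_q)%R *
      (x ^+ exponentB s (n + n' + m' * m * s^-1)%R (m + m')%R *
       y ^+ (m + m' : 'F_p)%R))%g by [].
  rewrite exponentD // /f; move: (exponentB s n m) (exponentB s n' m') => e e'.
  rewrite !expg_FpD //; have xz' := expg_conjg_Fp l' e q_pr zq xz.
  have yz' : commute (y ^+ m) (z ^+ l').
    exact: commuteX2 (commute_sym zy').
  have xy' : commute (x ^+ e') (y ^+ m).
    exact: commuteX2 (commute_sym yx').
  rewrite -!mulgA; congr (_ * _)%g; rewrite !mulgA -xz' -!mulgA.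
  congr (_ * _)%g; rewrite !mulgA yz' -!mulgA; congr (_ * _)%g.
  by rewrite !mulgA xy'.
apply/homgP; exists (Morphism fM).
have := subxx H; rewrite -{1}defH !join_subG !cycle_subG.
case/andP=> /andP[xH yH] zH.
apply/eqP; rewrite eqEsubset; apply/andP; split.
  apply/subsetP => _ /morphimP[[[n m] l] _ _ ->].
  by rewrite /= !groupM ?groupX.
rewrite -{1}defH !join_subG !cycle_subG.
have im a : f a \in (Morphism fM @* [set: B])%g.
  by apply: mem_morphim; rewrite inE.
have f_pelt j m : f (pelt j m) = (x ^+ j * y ^+ m)%g.
  by rewrite -[LHS]/(z ^+ 0 * (x ^+ exponentB s (pelt j m).1.1 m * y ^+ m))%g
    exponent_pelt expg0 mul1g.
have := im (pelt 1 0); rewrite f_pelt mulg1 => ->.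
have := im (pelt 0 1); rewrite f_pelt mul1g => ->.
have := im (qelt 1).
rewrite -[f _]/(z ^+ 1 * (x ^+ exponentB s 0 0 * y ^+ 0))%g.
by rewrite exponentB0 !expg0 !mulg1.
Qed.

End Presentation.

(** * Kernel, torsion and fixed vectors in a finite left brace *)

Section FiniteBrace.

Variable A : finLeftBraceType.
Implicit Types a b : A.

Lemma ker_lambdaP a : reflect (forall b, lambda a b = b) (a \in ker_lambda A).
Proof. by rewrite inE; apply: (iffP forallP) => h b; apply/eqP/h. Qed.

Lemma ker_lambda_group_set : group_set (ker_lambda A).
Proof.
apply/group_setP; split; first by apply/ker_lambdaP => b; rewrite lambda1.
move=> a b /ker_lambdaP ha /ker_lambdaP hb.
by apply/ker_lambdaP => c; rewrite lambdaM hb ha.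
Qed.

Canonical ker_lambda_group := Group ker_lambda_group_set.

Lemma ker_lambda_normal : (ker_lambda A <| [set: A])%g.
Proof.
apply/normalP; split=> [|a _]; first exact: subsetT.
apply/eqP; rewrite eqEcard cardJg leqnn andbT.
apply/subsetP => _ /imsetP[b /ker_lambdaP hb ->].
apply/ker_lambdaP => c.
by rewrite conjgE !lambdaM hb -lambdaM mulVg lambda1.
Qed.

Definition torsion n := [set a : A | a *+ n == 0].

(** Additive torsion is stable under each additive map [lambda a], hence closed under
    [a o b = a + lambda a b]. *)
Lemma torsion_group_set n : group_set (torsion n).
Proof.
apply/group_setP; split; first by rewrite inE brace_one mul0rn.
move=> a b; rewrite !inE => /eqP ha /eqP hb.
by rewrite brace_mulE mulrnDl -raddfMn hb ha raddf0 addr0.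
Qed.

Canonical torsion_group n := Group (torsion_group_set n).

Lemma mem_torsion_lambda n a b : (lambda a b \in torsion n) = (b \in torsion n).
Proof.
rewrite !inE -raddfMn; apply/eqP/eqP => [|->]; last by rewrite raddf0.
by move/(congr1 (lambda a^-1%g)); rewrite raddf0 lambdaK.
Qed.

(** The inverse turns the left action [lambda] into a right action. *)
Definition lambda_act b a := lambda a^-1%g b.

Lemma lambda_act1 : lambda_act^~ 1%g =1 id.
Proof. by move=> b; rewrite /lambda_act invg1 lambda1. Qed.

Lemma lambda_actM b : act_morph lambda_act b.
Proof. by move=> a c; rewrite /lambda_act invMg lambdaM. Qed.

Definition lambda_action := TotalAction lambda_act1 lambda_actM.

(** The [p]-group [torsion p] acts on itself through [lambda], so [p] divides the number of fixed
    points; as [0] is fixed, there is another one. *)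
Lemma torsion_fixed_vector p :
    prime p -> (p.-group (torsion p))%g -> (1 < #|torsion p|)%N ->
  exists e, [/\ e != 0, e \in torsion p &
    forall a, a \in torsion p -> lambda a e = e].
Proof.
move=> p_pr pT T_gt1.
have acts : [acts torsion p, on torsion p | lambda_action]%g.
  apply/subsetP => a _; rewrite !inE; apply/subsetP => b Tb.
  by rewrite inE /= /lambda_act mem_torsion_lambda.
have := pgroup_fix_mod pT acts.
set F := ('Fix_(_ | _)(_))%g => cardF.
have F0 : 0 \in F.
  rewrite inE -brace_one group1; apply/afixP => a _ /=.
  by rewrite /lambda_act brace_one raddf0.
have : (1 < #|F|)%N.
  have pF : (p %| #|F|)%N.
    rewrite /dvdn -cardF -/(_ %| _)%N; have [k Tk] := p_natP pT.
    by rewrite Tk; case: k Tk T_gt1 => [->|k] //; rewrite expnS dvdn_mulr.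
  apply: leq_trans (prime_gt1 p_pr) _; apply: dvdn_leq pF.
  by apply/card_gt0P; exists 0.
case/card_gt1P => x [y] [Fx Fy xy].
have [e Fe e0] : exists2 e, e \in F & e != 0.
  have [x0|] := eqVneq x 0; last by exists x.
  by exists y => //; rewrite -x0 eq_sym.
move: Fe; rewrite inE => /andP[Te /afixP fixe]; exists e; split=> // a Ta.
by have := fixe _ (groupVr Ta); rewrite /= /lambda_act invgK.
Qed.

End FiniteBrace.

(** * Sylow subgroups in coordinates *)

Section Coordinates.

Variables (p q : nat) (p_pr : prime p) (q_pr : prime q) (p_gt2 : (2 < p)%N).
Variables (r : {unit 'F_q}) (ord_r : #[r]%g = p).
Hypothesis (q_mod_p2 : ~ (q = 1 %[mod p ^ 2])%N).
Variable A : finLeftBraceType.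

Local Notation V := ('F_p * 'F_p * 'F_q)%type.

(* [d] is the exponent of [r] in the action on [F_q]; it is a morphism for the
   circle operation of the [p]-part, and its quadratic term is forced by [t]. *)
Lemma quadratic_exponent (t : 'F_p) (d : 'F_p -> 'F_p -> 'F_p) :
    (forall n m x y, d (n + x + t * y * m) (m + y) = d n m + d x y) ->
  exists al be, forall n m, d n m = al * n + be * m - al * t * m ^+ 2 / 2.
Proof.
move=> dD; have half := double_half p_pr p_gt2.
have d0n n m : d n m = d n 0 + d 0 m by rewrite -dD addr0 add0r !mulr0 addr0.
have dn0 : forall n, d n 0 = d 1 0 * n.
  by apply: additive_Fp_endoE => x y; rewrite -dD !mulr0 !addr0.
(* Additivity of [d 0] fails by [d 1 0 * t * x * y], the polarization of the quadratic term added
   here. *)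
pose del m := d 0 m + d 1 0 * t * m ^+ 2 / 2.
have delE : forall m, del m = del 1 * m.
  apply: additive_Fp_endoE => x y; have := dD 0 x 0 y.
  rewrite !add0r d0n dn0 /del => /(canRL (addKr _)) ->.
  move: (d 1 0) (d 0 x) (d 0 y) => al dx dy.
  by rewrite -[t * y * x]mul1r -{1}half; ring.
exists (d 1 0), (del 1) => n m; rewrite d0n dn0 -delE /del; ring.
Qed.

Variable phi : {additive A -> V}.
Hypothesis phi_bij : bijective phi.

Lemma mem_torsion_p a : (a \in torsion A p) = ((phi a).2 == 0).
Proof.
rewrite inE -(inj_eq (bij_inj phi_bij)) raddfMn raddf0 mulrn_triple.
rewrite !xpair_eqE !mulrn_Fp // !eqxx mulrn_Fp_eq0 // coprime_sym.
exact: coprime_pq ord_r.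
Qed.

Lemma mem_torsion_q a : (a \in torsion A q) = ((phi a).1 == 0).
Proof.
rewrite inE -(inj_eq (bij_inj phi_bij)) raddfMn raddf0 mulrn_triple.
have co := coprime_pq p_pr q_pr ord_r.
by rewrite !xpair_eqE mulrn_Fp // eqxx andbT !mulrn_Fp_eq0.
Qed.

Lemma card_torsion_p : #|torsion A p| = (p ^ 2)%N.
Proof.
have -> : torsion A p = phi @^-1: setX [set: 'F_p * 'F_p] [set 0].
  by apply/setP => a; rewrite mem_torsion_p !inE.
rewrite on_card_preimset; last exact: onW_bij phi_bij.
by rewrite cardsX cards1 cardsT card_prod !card_Fp // muln1.
Qed.

Lemma card_torsion_q : #|torsion A q| = q.
Proof.
have -> : torsion A q = phi @^-1: setX [set (0 : 'F_p * 'F_p)] [set: 'F_q].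
  by apply/setP => a; rewrite mem_torsion_q !inE andbT.
rewrite on_card_preimset; last exact: onW_bij phi_bij.
by rewrite cardsX cards1 cardsT card_Fp // mul1n.
Qed.

Lemma card_brace : #|A| = (p ^ 2 * q)%N.
Proof. by rewrite (bij_eq_card phi_bij) !card_prod !card_Fp. Qed.

Hypothesis card_ker : #|ker_lambda A| = q.

(** By its order [ker_lambda A] is a Sylow [q]-subgroup of the circle group; being normal, it
    contains every [q]-element. *)
Lemma mem_ker_lambda_expg (a : A) : (a ^+ q)%g = 1%g -> a \in ker_lambda A.
Proof.
move=> aq; have Hall : (q.-Hall([set: A]) (ker_lambda A))%g.
  rewrite pHallE subsetT card_ker cardsT card_brace /=.
  rewrite partnM ?expn_gt0 ?prime_gt0 // (part_pnat_id (pnat_id q_pr)).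
  rewrite part_p'nat ?mul1n // p'natE // Euclid_dvdX // andbT.
  by rewrite -prime_coprime // coprime_sym (coprime_pq p_pr q_pr ord_r).
rewrite -cycle_subG (sub_normal_Hall Hall) ?ker_lambda_normal ?subsetT //.
rewrite /pgroup -orderE; apply: pnat_dvd (pnat_id q_pr).
by rewrite order_dvdn aq.
Qed.

(** The [q]-torsion is a circle subgroup of order [q], so its elements have trivial [q]-th circle
    power; the cardinals agree. *)
Lemma ker_lambda_torsion : ker_lambda A = torsion A q.
Proof.
apply/esym/eqP; rewrite eqEcard card_ker card_torsion_q leqnn andbT.
apply/subsetP => a Ta; apply: mem_ker_lambda_expg.
have /eqP := order_dvdG Ta; rewrite -/(_ %| _)%N card_torsion_q.
by move=> /eqP; rewrite -/(_ %| _)%N order_dvdn => /eqP.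
Qed.

(** [a + v = a o lambda_a^-1 (v)], and the second factor lies in the kernel. *)
Lemma lambda_torsion a v b : v \in torsion A q -> lambda (a + v) b = lambda a b.
Proof.
move=> Tv; have Tw : lambda a^-1%g v \in ker_lambda A.
  by rewrite ker_lambda_torsion mem_torsion_lambda.
have -> : a + v = (a * lambda a^-1%g v)%g.
  by rewrite brace_mulE -lambdaM mulgV lambda1.
by rewrite lambdaM (ker_lambdaP _ Tw).
Qed.

Lemma torsion_p_commute a b :
  a \in torsion A p -> b \in torsion A p -> commute a b.
Proof.
have abT : abelian (torsion A p).
  apply: (@p2group_abelian _ p); rewrite /pgroup card_torsion_p ?pfactorK //.
  by rewrite pnatX pnat_id.
by move=> Ta Tb; apply: (centsP abT).
Qed.

Lemma fixed_vector : exists e : A,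
  [/\ e != 0, e \in torsion A p & forall a, lambda a e = e].
Proof.
have pT : p.-group%g (torsion A p).
  by rewrite /pgroup card_torsion_p pnatX pnat_id.
have [|e [e0 Te fix_e]] := torsion_fixed_vector p_pr pT.
  by rewrite card_torsion_p -[1%N](exp1n 2) ltn_exp2r ?prime_gt1.
exists e; split=> // a; have [psi phiK psiK] := phi_bij.
(* [v] is the [q]-part of [a], so [lambda a = lambda (a - v)] with [a - v] in the [p]-torsion, which
   fixes [e]. *)
pose v := psi (0, (phi a).2).
have Tv : v \in torsion A q by rewrite mem_torsion_q psiK.
rewrite -(subrK v a) (lambda_torsion _ _ Tv) fix_e //.
rewrite mem_torsion_p raddfB psiK; apply/eqP; exact: subrr.
Qed.

End Coordinates.

(** * Moving a vector of the [p]-part to [(1, 0, 0)] *)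

Section Normalization.

Variables p q : nat.
Hypothesis p_pr : prime p.

Local Notation V := ('F_p * 'F_p * 'F_q)%type.

(** A swap and a scaling suffice when the first coordinate vanishes; otherwise a scaling and a shear
    do. *)
Lemma exists_additive_triple (v : V) : v.1 != 0 -> v.2 = 0 ->
  exists2 g : {additive V -> V}, bijective g & g v = (1, 0, 0).
Proof.
case: v => [[x y] l] /= v0 ->; have [x0|x0] := eqVneq x 0.
  have y0 : y != 0 by apply: contraNneq v0 => ->; rewrite x0.
  pose f (u : V) : V := let: (n, m, z) := u in (m / y, n, z).
  have fB : zmod_morphism f.
    by move=> [[n m] z] [[n' m'] z']; congr (_, _, _); apply: mulrBl.
  pose g : {additive V -> V} := HB.pack f (GRing.isZmodMorphism.Build _ _ f fB).
  exists g; last first.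
    by rewrite /= x0 divff.
  exists (fun u : V => let: (n, m, z) := u in (m, n * y, z)) => -[[n m] z] /=.
    by rewrite divfK.
  by rewrite mulfK.
pose f (u : V) : V := let: (n, m, z) := u in (n / x, m - n * (y / x), z).
have fB : zmod_morphism f.
  have subl (a b c d k : 'F_p) : b - d - (a - c) * k = b - a * k - (d - c * k).
    by ring.
  move=> [[n m] z] [[n' m'] z'].
  by congr (_, _, _); [apply: mulrBl | apply: subl].
pose g : {additive V -> V} := HB.pack f (GRing.isZmodMorphism.Build _ _ f fB).
exists g; last first.
  by rewrite /= divff // mulrC divfK // subrr.
exists (fun u : V => let: (n, m, z) := u in (n * x, m + n * y, z)) =>
  -[[n m] z] /=.
  by rewrite divfK // mulrAC -mulrA subrK.
rewrite mulfK //; congr (_, _, _).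
by rewrite -mulrA (mulrC x) divfK // addrK.
Qed.

End Normalization.

(** * The form of [lambda] in coordinates *)

Section Structure.

Variables (p q : nat) (p_pr : prime p) (q_pr : prime q) (p_gt2 : (2 < p)%N).
Variables (r : {unit 'F_q}) (ord_r : #[r]%g = p).
Hypothesis (q_mod_p2 : ~ (q = 1 %[mod p ^ 2])%N).

Local Notation V := ('F_p * 'F_p * 'F_q)%type.

(** The order of [k] divides [p^2] and, by Fermat, [q - 1]; it is not [p^2], so it divides [p], and
    [r] is a primitive [p]-th root of unity. *)
Lemma root_of_unity_p2 (k : 'F_q) :
  k ^+ (p ^ 2) = 1 -> exists i : 'F_p, k = (val r : 'F_q) ^+ i.
Proof.
move=> kp2; have p2_gt0 : (0 < p ^ 2)%N by rewrite expn_gt0 prime_gt0.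
have [m m_prim] := prim_order_exists p2_gt0 kp2.
case/(dvdn_pfactor _ _ p_pr) => e e_le2 mE.
have q_mod_m : (q == 1 %[mod m])%N.
  by rewrite -(eq_prim_root_expr m_prim) expr1 expr_Fp.
have m_dvd_p : (m %| p)%N.
  rewrite mE -{2}(expn1 p) dvdn_exp2l //; move: e_le2.
  rewrite leq_eqVlt => /orP[/eqP e2|//].
  by case: q_mod_p2; rewrite -[2%N]e2 -mE; apply/eqP.
have kp : k ^+ p = 1.
  by apply/eqP; rewrite -(prim_order_dvd m_prim).
have [i ->] := prim_rootP (prim_root_r p_pr ord_r) kp.
by exists (i : nat)%:R; rewrite val_Fp_nat // modn_small.
Qed.

Variables (A : finLeftBraceType) (phi : {additive A -> V}).
Hypothesis phi_bij : bijective phi.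
Hypothesis card_ker : #|ker_lambda A| = q.

Lemma lambda_coordinates (e : A) :
    phi e = (1, 0, 0) -> (forall a, lambda a e = e) ->
  exists t al be : 'F_p, [/\ t != 0, al != 0 & forall a b,
    phi (lambda a b) =
      ((phi b).1.1 + t * (phi b).1.2 * (phi a).1.2, (phi b).1.2,
       (phi b).2 * (val r : 'F_q) ^+
         (al * (phi a).1.1 + be * (phi a).1.2
            - al * t * (phi a).1.2 ^+ 2 / 2 : 'F_p)%R)].
Proof.
move=> phie fix_e; have [psi phiK psiK] := phi_bij.
have psiB : zmod_morphism psi.
  by move=> u v; apply: (can_inj phiK); rewrite raddfB !psiK.
pose psiA : {additive V -> A} :=
  HB.pack psi (GRing.isZmodMorphism.Build _ _ psi psiB).
pose L a : {additive V -> V} := phi \o lambda a \o psiA.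
have psi1 : psi (1, 0, 0) = e by rewrite -phie phiK.
(* Entries of the matrix of [lambda a]; its first column is that of the identity because [e] is
   fixed. *)
pose c a : 'F_p := (L a (0, 1, 0)).1.1; pose y a : 'F_p := (L a (0, 1, 0)).1.2.
pose k a : 'F_q := (L a (0, 0, 1)).2.
have LE a (u v : 'F_p) (w : 'F_q) :
  L a (u, v, w) = (u + c a * v, y a * v, k a * w).
  rewrite (additive_VE p_pr q_pr ord_r) -/(c a) -/(y a) -/(k a).
  have -> : L a (1, 0, 0) = (1, 0, 0) by rewrite /= psi1 fix_e.
  by rewrite mul1r mul0r add0r.
have LM a b v : L (a * b)%g v = L a (L b v) by rewrite /= lambdaM phiK.
have yM a b : y (a * b)%g = y a * y b.
  by rewrite {1}/y LM (LE b) LE !mulr1.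
have kM a b : k (a * b)%g = k a * k b.
  by rewrite {1}/k LM (LE b) LE !mulr1.
have y1 : y 1%g = 1 by rewrite /y /= lambda1 psiK.
have k1 : k 1%g = 1 by rewrite /k /= lambda1 psiK.
have yX a n : y (a ^+ n)%g = y a ^+ n.
  by elim: n => [|n IHn]; rewrite ?expg0 ?y1 // expgS yM IHn exprS.
have kX a n : k (a ^+ n)%g = k a ^+ n.
  by elim: n => [|n IHn]; rewrite ?expg0 ?k1 // expgS kM IHn exprS.
(* The circle group has order [p^2 q], so the [q]-th power of [a ^ (p ^ 2)] is trivial. *)
have ap2 a : (a ^+ (p ^ 2))%g \in ker_lambda A.
  apply: (mem_ker_lambda_expg p_pr q_pr ord_r phi_bij card_ker).
  rewrite -expgM -(card_brace p_pr q_pr phi_bij) -cardsT.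
  by rewrite expg_cardG ?inE.
have Lker a v : a \in ker_lambda A -> L a v = v.
  by move=> /ker_lambdaP ha; rewrite /= ha psiK.
(* A [p^2]-th root of unity in [F_p] is [1], since [x ^ p = x] there. *)
have yE a : y a = 1.
  have : y a ^+ (p ^ 2) = 1 by rewrite -yX /y Lker.
  by rewrite expnS expn1 exprM !expr_Fp.
have kE a : exists i : 'F_p, k a = (val r : 'F_q) ^+ i.
  by apply: root_of_unity_p2; rewrite -kX /k Lker.
have [d dE] := fin_all_exists kE.
have dM a b : d (a * b)%g = d a + d b.
  apply: (expr_r_inj p_pr ord_r).
  by rewrite (expr_FpD p_pr ord_r) -!dE kM.
have phiM a b : phi (a * b)%g = phi a + L a (phi b).
  by rewrite brace_mulE raddfD /= phiK.
pose u (n m : 'F_p) : A := psi (n, m, 0).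
have Tu n m : u n m \in torsion A p.
  by rewrite (mem_torsion_p p_pr q_pr ord_r phi_bij) psiK.
(* First coordinates of [u n m o u 0 1 = u 0 1 o u n m]. *)
have ca n m : c (u n m) = c (u 0 1) * m.
  have := torsion_p_commute p_pr q_pr ord_r phi_bij (Tu n m) (Tu 0 1).
  move/(congr1 phi); rewrite !phiM !psiK !LE.
  move/(congr1 (fun v : V => v.1.1)) => h.
  have {}h : n + (0 + c (u n m) * 1) = 0 + (n + c (u 0 1) * m) := h.
  by move: h; rewrite mulr1 !add0r => /addrI.
pose t := c (u 0 1).
have uM n m x z : (u n m * u x z)%g = u (n + x + t * z * m) (m + z).
  apply: (bij_inj phi_bij); rewrite phiM !psiK LE ca yE -/t mulr0 mul1r.
  by rewrite !addr_triple addr0 !addrA mulrAC.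
have [al [be DE]] := quadratic_exponent p_pr p_gt2
  (fun n m x z => etrans (congr1 d (esym (uM n m x z))) (dM _ _)).
have Lu a v : L a v = L (u (phi a).1.1 (phi a).1.2) v.
  have Tl : psi (0, (phi a).2) \in torsion A q.
    by rewrite (mem_torsion_q p_pr q_pr ord_r phi_bij) psiK.
  rewrite /= -[in RHS](lambda_torsion p_pr q_pr ord_r phi_bij card_ker _ _ Tl).
  congr (phi (lambda _ _)); apply: (bij_inj phi_bij); rewrite raddfD !psiK.
  by case: (phi a) => [[n m] l]; rewrite addr_triple !addr0 add0r.
(* Injectivity on the [p]-part: the kernel is the [q]-torsion, which meets it only in [0]. *)
have ker0 n m : c (u n m) = 0 -> d (u n m) = 0 -> n = 0 /\ m = 0.
  move=> c0 d0; have /ker_lambdaP : forall b, lambda (u n m) b = b.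
    move=> b; apply: (bij_inj phi_bij).
    rewrite -{1}(phiK b) -[LHS]/(L _ (phi b)).
    by case: (phi b) => [[x z] l]; rewrite LE c0 yE dE d0 mul0r addr0 !mul1r.
  rewrite (ker_lambda_torsion p_pr q_pr ord_r phi_bij card_ker).
  by rewrite (mem_torsion_q p_pr q_pr ord_r phi_bij) psiK => /eqP [-> ->].
have al0 : al != 0.
  apply/eqP => al0; have [||/eqP] := ker0 1 0; last by rewrite oner_eq0.
    by rewrite ca mulr0.
  by rewrite DE al0 expr0n !mul0r mulr0 subr0 addr0.
have t0 : t != 0.
  apply/eqP => t0.
  (* With [t = 0] the exponent is [al n + be m], which vanishes at [(- be / al, 1)]. *)
  have [||_ /eqP] := ker0 (- be / al) 1; last by rewrite oner_eq0.
    by rewrite ca -/t t0 mul0r.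
  by rewrite DE t0 mulr0 !mul0r subr0 mulrC divfK // mulr1 addNr.
exists t, al, be; split=> // a b.
rewrite -[b in lambda a b]phiK -[LHS]/(L a (phi b)) Lu.
case: (phi b) => [[x z] l].
by rewrite LE yE ca dE DE mul1r -/t mulrAC [X in (_, _, X)]mulrC.
Qed.

End Structure.

(** * Reduction to the braces [B_s] and the classification *)

(* Rescaling the second basis vector by [C] and shearing along the first one
   turns the exponent into the one of [braceB]. *)
Lemma braceB_iso_of_coordinates (p q : nat) (p_pr : prime p) (p_gt2 : (2 < p)%N)
    (r : {unit 'F_q}) (ord_r : #[r]%g = p) (A : leftBraceType)
    (phi : {additive A -> 'F_p * 'F_p * 'F_q}) (t al be s C : 'F_p) :
    bijective phi -> t != 0 -> al != 0 -> s != 0 -> C ^+ 2 = al * t * s ->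
    (forall a b, phi (lambda a b) =
      ((phi b).1.1 + t * (phi b).1.2 * (phi a).1.2, (phi b).1.2,
       (phi b).2 * (val r : 'F_q) ^+
         (al * (phi a).1.1 + be * (phi a).1.2
            - al * t * (phi a).1.2 ^+ 2 / 2 : 'F_p)%R)) ->
  brace_isomorphic A (braceB p_pr p_gt2 ord_r s).
Proof.
move=> phi_bij t0 al0 s0 C2 lamE; have half := double_half p_pr p_gt2.
have two0 : (2 : 'F_p) != 0.
  by apply: contra_eqN half => /eqP ->; rewrite mul0r eq_sym oner_eq0.
have C0 : C != 0 by rewrite -sqrf_eq0 C2 !mulf_neq0.
have [psi phiK psiK] := phi_bij.
(* The exponent of [B_s] expands to [n + m/2 - m^2/(2s)]. At second coordinate [C m] its linear term
   [C m/2] is cancelled by the [C/2] here, and [C^2/s = al t] matches the quadratic terms. *)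
pose g (n m : 'F_p) : 'F_p := al * n + (be - C / 2) * m.
pose f (a : A) : braceB p_pr p_gt2 ord_r s :=
  let: (n, m, l) := phi a in (g n m, C * m, l).
have tE : t = C * C / s / al.
  by rewrite -expr2 C2 mulfK // mulrAC divff // mul1r.
have expE n m : exponentB s (g n m) (C * m) =
    al * n + be * m - al * t * m ^+ 2 / 2.
  by rewrite /exponentB /g tE; field; rewrite s0 al0 two0.
exists f; split.
- pose g' (n m : 'F_p) : 'F_p := (n - (be - C / 2) * (m / C)) / al.
  have gK n m : g' (g n m) (C * m) = n.
    by rewrite /g' /g; field; rewrite al0 C0 two0.
  have g'K n m : g (g' n m) (m / C) = n.
    by rewrite /g' /g; field; rewrite al0 C0 two0.
  have CK (m : 'F_p) : C * m / C = m by rewrite mulrAC divff // mul1r.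
  have CK' (m : 'F_p) : C * (m / C) = m by rewrite mulrC divfK.
  pose f' (b : 'F_p * 'F_p * 'F_q) : A :=
    let: (n, m, l) := b in psi (g' n m, m / C, l).
  exists f' => [a|[[n m] l]].
    rewrite -{2}(phiK a) /f; case: (phi a) => [[n m] l].
    by rewrite /f' gK CK.
  by rewrite /f psiK g'K CK'.
- move=> a b; rewrite /f raddfD.
  case: (phi a) (phi b) => [[n m] l] [[x y] z].
  congr (_, _, _); last exact: mulrDr.
  have gD : g (n + x) (m + y) = g n m + g x y by rewrite /g; ring.
  exact: gD.
move=> a b; rewrite /f brace_mulE raddfD lamE.
case: (phi a) (phi b) => [[n m] l] [[x y] z].
congr (_, _, _); [| exact: mulrDr | by rewrite expE].
have gM : g (n + (x + t * y * m)) (m + y) =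
    g n m + g x y + (C * y) * (C * m) / s.
  by rewrite /g tE; field; rewrite s0 al0 two0.
exact: gM.
Qed.

Theorem proposition5p4 (p q : nat) (p_pr : prime p) (q_pr : prime q)
    (p_gt2 : (2 < p)%N)
    (q_mod_p : (q = 1 %[mod p])%N) (q_mod_p2 : ~ (q = 1 %[mod p ^ 2])%N)
    (r : {unit 'F_q}) (ord_r : #[r]%g = p)
    (w : 'F_p) (w_nonresidue : forall x : 'F_p, x ^+ 2 != w) :
  let B (s : 'F_p) : finLeftBraceType := braceB p_pr p_gt2 ord_r s in
  [/\ forall s : 'F_p, s = 1 \/ s = w ->
        additively_isomorphic (B s) ('F_p * 'F_p * 'F_q)%type
        /\ #|ker_lambda (B s)| = q,
      forall A : finLeftBraceType,
        additively_isomorphic A ('F_p * 'F_p * 'F_q)%type ->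
        #|ker_lambda A| = q ->
        brace_isomorphic A (B 1) \/ brace_isomorphic A (B w),
      ~ brace_isomorphic (B 1) (B w)
    & forall s : 'F_p, s = 1 \/ s = w ->
        ([set: B s] \isog Grp (sigma : tau : epsilon :
           sigma ^+ p = 1, tau ^+ p = 1, epsilon ^+ q = 1,
           [~ epsilon, tau] = 1, [~ tau, sigma] = 1,
           sigma * epsilon * sigma^-1 = epsilon ^+ (val r : 'F_q)))%g].
Proof.
move=> B.
have w0 : w != 0 by have := w_nonresidue 0; rewrite expr0n /= eq_sym.
have s_neq0 s : s = 1 \/ s = w -> s != 0 by case=> -> //; apply: oner_neq0.
split.
- move=> s /s_neq0 s0; split; first exact: additively_isomorphic_B.
  exact: card_ker_lambdaB.
- move=> A [phi0 phi0_bij] card_ker.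
  have [e [e0 Te fix_e]] := fixed_vector p_pr q_pr ord_r phi0_bij card_ker.
  have phi0e2 : (phi0 e).2 = 0.
    by apply/eqP; rewrite -(mem_torsion_p p_pr q_pr ord_r phi0_bij).
  have phi0e1 : (phi0 e).1 != 0.
    apply: contraNneq e0 => phi0e1; apply/eqP/(bij_inj phi0_bij).
    by rewrite raddf0 [LHS]surjective_pairing phi0e1 phi0e2.
  (* New coordinates make the fixed vector [e] the first basis vector. *)
  have [g g_bij ge] := exists_additive_triple phi0e1 phi0e2.
  pose phi : {additive A -> 'F_p * 'F_p * 'F_q} := g \o phi0.
  have phi_bij : bijective phi by apply: bij_comp.
  have [t [al [be [t0 al0 lamE]]]] :=
    lambda_coordinates p_pr q_pr p_gt2 ord_r q_mod_p2 phi_bij card_ker ge fix_e.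
  have [s s1w [C C2]] :=
    square_or_nonresidue_square (mulf_neq0 al0 t0) w_nonresidue.
  have iso := braceB_iso_of_coordinates p_pr p_gt2 ord_r phi_bij t0 al0
    (s_neq0 s s1w) C2 lamE.
  by case: s1w iso => ->; [left | right].
- case/(braceB_iso_square q_pr (oner_neq0 _) w0) => C.
  by rewrite mulr1; apply/eqP.
by move=> s _; apply: braceB_presentation.
Qed.
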